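(* Let $G$ be a countably infinite amenable group, let $\mathcal{A}$ be a finite alphabet, let $\mathcal{F}\subseteq\mathcal{A}^+_G$ be a set of patterns, and let $\beta$ be a positive real number such that $$|\mathcal{A}|-\sum_{f\in\mathcal{F}}|f|\beta^{1-|f|}\ge\beta$$ (in particular the sum converges). Then $$\alpha(X_{\mathcal{F}})\ge\beta\quad\text{and}\quad h(X_{\mathcal{F}})\ge\log\beta.$$
   Context: A pattern over $G$ is an element $p\in\mathcal{A}^S$ where $S\subseteq G$ is a non-empty finite set, called its support $\operatorname{supp}(p)$; its size is $|p|=|S|$; $\mathcal{A}^+_G$ is the set of all patterns. A pattern $f$ appears in a configuration $x\in\mathcal{A}^G$ if there is $g\in G$ with $x(gs)=f(s)$ for all $s\in\operatorname{supp}(f)$. $X_{\mathcal{F}}$ is the set of configurations in $\mathcal{A}^G$ in which no $f\in\mathcal{F}$ appears. For finite $S\subseteq G$, $\mathcal{G}_{\mathcal{F}}^{(S)}$ is the set of $p\in\mathcal{A}^S$ that appear in some $x\in X_{\mathcal{F}}$. The growth of $X_{\mathcal{F}}$ is $\alpha(X_{\mathcal{F}})=\lim_{n\to\infty}\big(\min_{S\subseteq G,|S|=n}|\mathcal{G}_{\mathcal{F}}^{(S)}|\big)^{1/n}$ (the limit exists). The topological entropy is $h(X_{\mathcal{F}})=\lim_{n\to\infty}\frac{\log|\mathcal{G}_{\mathcal{F}}^{(S_n)}|}{|S_n|}$ where $(S_n)$ is a symmetric Følner sequence of $G$: finite sets with $S_n=S_n^{-1}$ and $|(g\cdot S_n)\Delta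 S_n|/|S_n|\to0$ for every $g\in G$. *)

(* Defs.v *)
From HB Require Import structures.
From mathcomp Require Import all_boot all_order all_algebra finmap.
From mathcomp Require Import all_classical all_reals all_analysis.

Set Implicit Arguments.
Unset Strict Implicit.
Unset Printing Implicit Defensive.

Import Order.TTheory GRing.Theory Num.Theory.
Import numFieldNormedType.Exports.

Local Open Scope classical_set_scope.
Local Open Scope ring_scope.

Section Subshifts.
Context {G : groupType} {A : finType}.
Implicit Types (f : {fmap G -> A}) (x : G -> A) (F : set {fmap G -> A}).

(* A pattern over G is a finite map with non-empty domain: [domf f] is its
   support and [#|` domf f|] its size. *)
Definition patterns : set {fmap G -> A} := [set f | domf f != fset0].

Definition appears f x : Prop :=
  exists g : G, forall s : domf f, x (g * val s)%g = f s.

Definition subshift F : set (G -> A) :=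
  [set x | forall f, F f -> ~ appears f x].

(* [FinMap p] is p, an element of A^S, seen as a finite map with domain S. *)
Definition language F (S : {fset G}) : {set {ffun S -> A}} :=
  [set p : {ffun S -> A} |
    `[< exists2 x, subshift F x & appears (FinMap p) x >]].

Definition complexities F (n : nat) : set nat :=
  [set #|language F S| | S in [set S : {fset G} | #|` S| = n]].

(* The minimum of [complexities F n]; this set is non-empty when G is infinite,
   and the default value 0 is only taken when it is empty. *)
Definition min_complexity F (n : nat) : nat :=
  xget 0%N (complexities F n `&` lbound (complexities F n)).

(* The term n = 0 is irrelevant. *)
Definition growth {R : realType} F : R :=
  limn (fun n => (min_complexity F n)%:R `^ n%:R^-1 : R).

(* The limit is taken in the extended reals, with lne 0 = -oo, so that the
   entropy of the empty subshift is -oo. *)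
Definition entropy {R : realType} F (S : nat -> {fset G}) : \bar R :=
  limn (fun n => lne (#|language F (S n)|%:R%:E) * (#|` S n|%:R^-1)%:E : \bar R)%E.

End Subshifts.

Arguments patterns G A : clear implicits.

Section Amenability.
Context {G : groupType}.
Implicit Types (T : {fset G}) (S : nat -> {fset G}).

Definition ltranslate (g : G) T : {fset G} := [fset (g * t)%g | t in T]%fset.

Definition inv_fset T : {fset G} := [fset (t^-1)%g | t in T]%fset.

Definition symdiff (T U : {fset G}) : {fset G} :=
  ((T `\` U) `|` (U `\` T))%fset.

(* Non-emptiness gives a meaning to the quotients: in MathComp x / 0 = 0. *)
Definition folner {R : realType} S : Prop :=
  (forall n, S n != fset0) /\
  forall g : G,
    (fun n => #|` symdiff (ltranslate g (S n)) (S n)|%:R / #|` S n|%:R : R)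
      @ \oo --> (0 : R).

Definition symmetric_folner {R : realType} S : Prop :=
  @folner R S /\ forall n, S n = inv_fset (S n).

End Amenability.

Arguments folner {G} R S.
Arguments symmetric_folner {G} R S.

(* For a countable group, amenability is the existence of a Folner sequence. *)
Definition amenable (R : realType) (G : groupType) : Prop :=
  exists S : nat -> {fset G}, folner R S.

(* Main.v *)
Require Import Defs.
From HB Require Import structures.
From mathcomp Require Import all_boot all_order all_algebra finmap.
From mathcomp Require Import algC zify ring lra.
From mathcomp Require Import all_classical all_reals all_analysis.

Set Implicit Arguments.
Unset Strict Implicit.
Unset Printing Implicit Defensive.

Import Order.TTheory GRing.Theory Num.Theory.
Import numFieldNormedType.Exports.

Local Open Scope classical_set_scope.
Local Open Scope ring_scope.

(** Let V(S) be the set of configurations violating no constraint inside the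
    finite set S, and count traces (restrictions) on S.  Adding a point a to S
    multiplies the number of traces of V(S) by |A|; a new trace is lost only if
    some f in F occurs through a, in one of |f| positions, and is then determined
    by its values off that occurrence, so by induction at most
    |f| beta^(1-|f|) #V(S) traces are lost.  Hence #V(S) >= beta^|S|.

    This bounds locally valid patterns, not globally valid ones.  For the latter,
    fix K; by compactness there is T containing K such that every trace on K of
    V(T) extends to a point of the subshift X.  Shearer's inequality for the cover
    of a Folner set Q by the translates gK, most of which satisfy gT <= Q, gives
    beta^(|Q||K|) <= #V(Q)^|K| <= #X(K)^|Q| e^(o(|Q|)), that is,
    #X(K) >= beta^|K|.  The limit defining the growth exists by Fekete's lemma;
    the one defining the entropy exists because the same use of Shearer's
    inequality, with X in place of V(Q) and T = K, shows that it is the infimum of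
    log #X(K) / |K| over K. *)

(** * Counting the image of a set under a map to a finite type *)

Section CardImage.
Context {T : Type} {U : finType}.
Implicit Types (r : T -> U) (P Q : set T).

Definition image_set r P : {set U} := [set u | `[< exists2 x, P x & r x = u >]].

Definition card_image r P : nat := #|image_set r P|.

Lemma mem_image_set r P u : (u \in image_set r P) <-> exists2 x, P x & r x = u.
Proof. by rewrite inE; split=> /asboolP. Qed.

Lemma card_image_gt0 r P : P !=set0 -> (0 < card_image r P)%N.
Proof.
by move=> [x Px]; apply/card_gt0P; exists (r x); apply/mem_image_set; exists x.
Qed.

Lemma card_image_set0 r : card_image r set0 = 0%N.
Proof.
apply/eqP; rewrite cards_eq0; apply/eqP/setP => u; rewrite [RHS]inE.
by apply/negP => /mem_image_set [].
Qed.

Lemma card_imageU r P Q :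
  (card_image r (P `|` Q) <= card_image r P + card_image r Q)%N.
Proof.
apply: leq_trans (leq_card_setU _ _); apply/subset_leq_card/fintype.subsetP => u.
rewrite finset.in_setU => /mem_image_set[x [Px|Qx] <-]; apply/orP;
  by [left; apply/mem_image_set; exists x|right; apply/mem_image_set; exists x].
Qed.

(* The union may be infinite, but its image is finite: keep one index per image point. *)
Lemma card_image_bigU r (I : choiceType) (F : set I) (Z : I -> set T) :
  exists2 D : {fset I}, [set` D] `<=` F &
    (card_image r (\bigcup_(i in F) Z i) <= \sum_(i <- D) card_image r (Z i))%N.
Proof.
have [[i0 Fi0]|F0] := pselect (F !=set0); last first.
  exists fset0 => //; rewrite (_ : \bigcup_(i in F) Z i = set0) ?card_image_set0//.
  by rewrite -subset0 => x [i Fi _]; apply: F0; exists i.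
set E := image_set r (\bigcup_(i in F) Z i).
have /choice[c cP] (u : U) : exists i, F i /\ (u \in E -> u \in image_set r (Z i)).
  have [/mem_image_set [x [i Fi Zx] <-]|] := boolP (u \in E); last by exists i0.
  by exists i; split=> // _; apply/mem_image_set; exists x.
exists [fset c u | u in E]%fset; first by move=> i /imfsetP[u _ ->]; case: (cP u).
rewrite (_ : card_image _ _ = #|E|)//.
suff E_le (s : seq I) : (#|[set u in E | c u \in s]| <= \sum_(i <- s) card_image r (Z i))%N.
  apply: leq_trans (E_le _); apply: subset_leq_card; apply/fintype.subsetP => u uE.
  by rewrite inE uE/=; apply/imfsetP; exists u.
elim: s => [|i s IH].
  by rewrite big_nil leqn0 cards_eq0; apply/eqP/setP => u; rewrite !inE andbF.
rewrite big_cons; apply: leq_trans (leq_add (leqnn _) IH).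
rewrite (leq_trans _ (leq_card_setU _ _))//; apply: subset_leq_card; apply/fintype.subsetP => u.
rewrite inE => /andP[uE]; rewrite inE finset.in_setU => /orP[/eqP cu|cu].
  by apply/orP; left; rewrite -cu; apply: (cP u).2.
by apply/orP; right; rewrite inE uE.
Qed.

End CardImage.

(** Choosing one preimage in [P] for each value of [r] and applying [r' \o f] injects the first
    image into the second; [f] itself need not be injective. *)
Lemma leq_card_image (T T' : Type) (U U' : finType) (r : T -> U) (r' : T' -> U')
    (P : set T) (Q : set T') (f : T -> T') :
  (forall x, P x -> Q (f x)) ->
  (forall x y, P x -> P y -> r' (f x) = r' (f y) -> r x = r y) ->
  (card_image r P <= card_image r' Q)%N.
Proof.
move=> PQ inj.
have [->|/set0P[x0 Px0]] := eqVneq P set0; first by rewrite card_image_set0.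
have /choice[c cP] (u : U) : exists x, P x /\ (u \in image_set r P -> r x = u).
  by have [/mem_image_set[x Px <-]|] := boolP (u \in image_set r P); [exists x|exists x0].
rewrite /card_image -(card_in_imset (f := r' \o f \o c)); last first.
  move=> u v /(cP u).2 ru /(cP v).2 rv /= /inj cuv; rewrite -ru -rv.
  exact: cuv (cP u).1 (cP v).1.
apply/subset_leq_card/fintype.subsetP => _ /imsetP[u uP ->].
by apply/mem_image_set; exists (f (c u)) => //; apply/PQ/(cP u).1.
Qed.

Lemma card_image_pair (T : Type) (U A : finType) (r : T -> U) (v : T -> A) (P : set T) :
  card_image (fun x => (r x, v x)) P =
  (\sum_(a : A) card_image r (P `&` [set x | v x = a]))%N.
Proof.
set E := image_set (fun x => (r x, v x)) P.
transitivity (\sum_(p : U * A) ((p.1, p.2) \in E))%N.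
  by rewrite /card_image -sum1_card big_mkcond; apply: eq_bigr => -[u a] _; case: ifP.
rewrite -(pair_big predT predT (fun u a => ((u, a) \in E) : nat))/= exchange_big/=.
apply: eq_bigr => a _; rewrite /card_image -sum1_card [RHS]big_mkcond.
apply: eq_bigr => u _; rewrite (_ : _ \in E = (u \in image_set r (P `&` [set x | v x = a]))).
  by case: ifP.
apply/idP/idP => /mem_image_set[x].
  by move=> Px [<- <-]; apply/mem_image_set; exists x.
by move=> [Px /= <-] <-; apply/mem_image_set; exists x.
Qed.

(* By AM-GM applied to the normalised terms c j a / \sum_a c j a; algC provides
   the #|J|-th root. *)
Lemma expn_sum_le_prod (A J : finType) (M : A -> nat) (B : nat)
    (c : J -> A -> nat) : (0 < #|J|)%N ->
  (forall a, M a ^ #|J| <= B * \prod_j c j a)%N ->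
  ((\sum_a M a) ^ #|J| <= B * \prod_j \sum_a c j a)%N.
Proof.
move=> J0 le_M; set C := fun j => (\sum_a c j a)%N; set k := #|J| in J0 le_M *.
have c_le j a : (c j a <= C j)%N by rewrite /C (bigD1 a)//= leq_addr.
set N := (B * \prod_j C j)%N.
have [N0|N_gt0] := posnP N.
  suff M0 a : M a = 0%N by rewrite (eq_bigr (fun=> 0%N)) ?sum_nat_const ?muln0 ?exp0n.
  suff: (M a ^ k == 0)%N by rewrite expn_eq0 => /andP[/eqP].
  rewrite -leqn0 -N0.
  apply: leq_trans (le_M a) _; rewrite leq_mul2l; apply/orP; right.
  by apply: leq_prod => j _; apply: c_le.
have Cj_gt0 j : (0 < C j)%N.
  by move: N_gt0; rewrite muln_gt0 => /andP[_]; rewrite (bigD1 j)//= muln_gt0 => /andP[].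
(* With [X] the [k]-th root of the right-hand side, the claim becomes linear: the [M a] sum to at
   most [X]. *)
set X : algC := k.-root N%:R.
have X_gt0 : 0 < X by rewrite rootC_gt0// ltr0n.
have XE : X ^+ k = N%:R by rewrite rootCK.
have M_le a : (M a)%:R / X <= (\sum_j (c j a)%:R / (C j)%:R) / k%:R.
  rewrite -(ler_pXn2r (n := k))// ?nnegrE; last 2 first.
  - by rewrite divr_ge0// ltW.
  - by rewrite divr_ge0// sumr_ge0// => j _; rewrite divr_ge0.
  have := (@leif_AGM algC J J (fun j => (c j a)%:R / (C j)%:R) _).1.
  rewrite -/k => /(_ (fun j _ => divr_ge0 (ler0n _ _) (ler0n _ _))); apply: le_trans.
  rewrite expr_div_n XE ler_pdivrMr ?ltr0n// prodf_div -!natr_prod.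
  have -> : (\prod_j c j a)%:R / (\prod_j C j)%:R * N%:R = (B * \prod_j c j a)%:R :> algC.
    rewrite /N !natrM mulrC -mulrA [_ * (_ / _)]mulrCA divff ?mulr1//.
    by rewrite pnatr_eq0 -lt0n prodn_gt0.
  by rewrite -natrX ler_nat.
change ((\sum_a M a) ^ k <= N)%N.
rewrite -(ler_nat algC) natrX -XE (ler_pXn2r J0) ?nnegrE ?ler0n ?(ltW X_gt0)//.
rewrite -[leRHS]mul1r -ler_pdivrMr//.
rewrite natr_sum mulr_suml (le_trans (ler_sum _ (fun a _ => M_le a)))//.
rewrite -mulr_suml exchange_big/= ler_pdivrMr ?ltr0n// mul1r.
rewrite (eq_bigr (fun=> 1)) => [|j _]; first by rewrite sumr_const.
transitivity ((C j)%:R / (C j)%:R : algC); first by rewrite {1}/C natr_sum mulr_suml.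
by rewrite divff// pnatr_eq0 -lt0n.
Qed.

(** * Traces on finite sets and Shearer's inequality *)

Section Traces.
Context {I : choiceType} {A : finType}.
Implicit Types (J K U : {fset I}) (P Q : set (I -> A)).

Definition trace J (x : I -> A) : {ffun J -> A} := [ffun s => x (val s)].

Definition ntraces J P : nat := card_image (trace J) P.

Lemma eq_trace J x y : trace J x = trace J y <-> {in J, x =1 y}.
Proof.
split=> [/ffunP xy s sJ|xy]; first by have := xy [` sJ]%fset; rewrite !ffunE.
by apply/ffunP => s; rewrite !ffunE xy// fsvalP.
Qed.

Lemma leq_ntraces J K P Q : (J `<=` K)%fset -> P `<=` Q ->
  (ntraces J P <= ntraces K Q)%N.
Proof.
move=> JK PQ; apply: (leq_card_image (f := id)) => // x y _ _ /eq_trace xy.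
by apply/eq_trace => s sJ; apply/xy/(fsubsetP JK).
Qed.

Lemma ntraces_gt0 J P : P !=set0 -> (0 < ntraces J P)%N.
Proof. exact: card_image_gt0. Qed.

Lemma ntraces_le_expn J P : (ntraces J P <= #|A| ^ #|` J|)%N.
Proof. by rewrite cardfE -card_ffun max_card. Qed.

Lemma ntraces_fset1U i J P :
  ntraces (i |` J)%fset P = (\sum_(a : A) ntraces J (P `&` [set x | x i = a]))%N.
Proof.
rewrite -card_image_pair; apply/eqP; rewrite eqn_leq; apply/andP; split;
  apply: (leq_card_image (f := id)) => // x y _ _.
  move=> [/eq_trace xy xyi]; apply/eq_trace => s.
  by rewrite in_fset1U => /orP[/eqP ->|/xy].
move=> /eq_trace xy; rewrite (xy i) ?fset1U1//; congr pair.
by apply/eq_trace => s sJ; apply: xy; rewrite in_fset1U sJ orbT.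
Qed.

Lemma ntracesU J K P : (ntraces (J `|` K)%fset P <= ntraces J P * ntraces K P)%N.
Proof.
rewrite /ntraces /card_image -cardsX.
apply: (@leq_trans (card_image (fun x => (trace J x, trace K x)) P)).
  apply: (leq_card_image (f := id)) => // x y _ _ [/eq_trace xyJ /eq_trace xyK].
  by apply/eq_trace => s; rewrite in_fsetU => /orP[/xyJ|/xyK].
apply/subset_leq_card/fintype.subsetP => _ /mem_image_set[x Px <-].
by rewrite finset.in_setX; apply/andP; split; apply/mem_image_set; exists x.
Qed.

(* Fixing the value at a point i of U splits the traces on the k sets containing
   i, and [expn_sum_le_prod] recombines the resulting k-fold products. *)
Lemma shearer (k : nat) U (Js : seq {fset I}) P : (0 < k)%N ->
  {in U, forall i, count (fun J : {fset I} => i \in J) Js = k} ->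
  (ntraces U P ^ k <= \prod_(J <- Js) ntraces (J `&` U)%fset P)%N.
Proof.
move=> k_gt0; elim/fset1U_rect: U P => [|i U iU IH] P cover.
  have [->|/set0P P0] := eqVneq P set0; first by rewrite /ntraces card_image_set0 exp0n.
  have ntraces0 : (ntraces fset0 P <= 1)%N.
    by rewrite (leq_trans (ntraces_le_expn _ _))// cardfs0.
  rewrite (leq_trans (n := 1%N))//; last by apply: prodn_gt0 => J; apply: ntraces_gt0.
  by rewrite -(exp1n k) leq_exp2r.
rewrite (bigID (fun J : {fset I} => i \in J))/= mulnC -[X in (_ <= _ * X)%N]big_filter.
set s : seq {fset I} := [seq J : {fset I} <- Js | i \in J].
have size_s : size s = k by rewrite size_filter cover// fset1U1.
rewrite ntraces_fset1U [X in (_ <= _ * X)%N]big_tnth.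
under [X in (_ <= _ * X)%N]eq_bigr => l _.
  have := mem_tnth l (in_tuple s); rewrite mem_filter => /andP[il _].
  have -> : (tnth (in_tuple s) l `&` (i |` U) = i |` (tnth (in_tuple s) l `&` U))%fset.
    by apply/fsetP => u; rewrite !inE; case: eqVneq => // ->; rewrite il.
  rewrite ntraces_fset1U; over.
have card_s : #|'I_(size s)| = k by rewrite card_ord.
rewrite -[X in (_ ^ X)%N]card_s; apply: expn_sum_le_prod => [|a]; first by rewrite card_s.
rewrite card_s (leq_trans (IH _ _))// => [u uU|].
  by apply: cover; rewrite fset1Ur.
(* The members of [Js] that miss [i] contribute the constant [B]: fixing the value at [i] only
   lowers their trace counts. *)
rewrite (bigID (fun J : {fset I} => i \in J))/= mulnC -[X in (_ * X <= _)%N]big_filter -/s.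
rewrite [X in (_ * X <= _)%N]big_tnth leq_mul//.
apply: leq_prod => J _; apply: leq_ntraces => [|x []//].
by rewrite fsetIS// fsubsetU1.
Qed.

End Traces.

(** * Growth of the number of locally valid patterns *)

Section LocallyValid.
Context {G : groupType} {A : finType}.
Implicit Types (f : {fmap G -> A}) (g : G) (x : G -> A) (S T : {fset G}).

Lemma mem_ltranslate g T h : (h \in ltranslate g T) = (g^-1 * h \in T)%g.
Proof.
apply/imfsetP/idP => [[t tT ->]|ghT]; first by rewrite mulKg.
by exists (g^-1 * h)%g; rewrite ?mulVKg.
Qed.

Lemma card_ltranslate g T : #|` ltranslate g T| = #|` T|.
Proof. by rewrite card_imfset//; apply: mulgI. Qed.

Definition occurs_at f g x := forall s : domf f, x (g * val s)%g = f s.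

Lemma eq_occurs_at f g x y : {in ltranslate g (domf f), x =1 y} ->
  occurs_at f g x -> occurs_at f g y.
Proof. by move=> xy fx s; rewrite -xy ?fx// mem_ltranslate mulKg fsvalP. Qed.

Variable F : set {fmap G -> A}.

(** This is V(S). Only occurrences lying entirely in [S] are excluded, so membership depends on the
    values on [S] alone. *)
Definition locally_valid S : set (G -> A) := [set x | forall f g, F f ->
  (ltranslate g (domf f) `<=` S)%fset -> ~ occurs_at f g x].

Definition nvalid S : nat := ntraces S (locally_valid S).

Lemma locally_validS S T : (S `<=` T)%fset -> locally_valid T `<=` locally_valid S.
Proof. by move=> ST x Tx f g Ff fS; apply: Tx => //; apply: fsubset_trans ST. Qed.

Lemma eq_locally_valid S x y : {in S, x =1 y} -> locally_valid S x -> locally_valid S y.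
Proof.
move=> xy Sx f g Ff fS; move=> fy; apply: (Sx f g Ff fS); apply: eq_occurs_at fy.
by move=> h /(fsubsetP fS) hS; rewrite xy.
Qed.

(** Validity on [S] ignores the value at [a], which can be overwritten by any letter. *)
Lemma ntraces_locally_valid_fset1U a S : a \notin S ->
  ntraces (a |` S)%fset (locally_valid S) = (#|A| * nvalid S)%N.
Proof.
move=> aS; rewrite ntraces_fset1U; under eq_bigr => b _.
  have -> : ntraces S (locally_valid S `&` [set x | x a = b]) = nvalid S.
    apply/eqP; rewrite eqn_leq leq_ntraces//=.
    set u := fun (x : G -> A) h => if h == a then b else x h.
    have uE x : {in S, x =1 u x}.
      by move=> h hS; rewrite /u; case: eqVneq => // ha; rewrite -ha hS in aS.
    apply: (leq_card_image (f := u)) => [x Sx|x y _ _ /eq_trace uxy].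
      by split; [apply: eq_locally_valid Sx|rewrite /= /u eqxx].
    by apply/eq_trace => h hS; rewrite (uE x)// (uE y)// uxy.
  over.
by rewrite sum_nat_const.
Qed.

Hypothesis F_patterns : F `<=` patterns G A.

Definition violates_at a S f : set (G -> A) := [set x | locally_valid S x /\
  exists g, [/\ a \in ltranslate g (domf f),
    (ltranslate g (domf f) `<=` a |` S)%fset & occurs_at f g x]].

Lemma locally_valid_fset1U a S :
  locally_valid S `<=` locally_valid (a |` S)%fset `|` \bigcup_(f in F) violates_at a S f.
Proof.
move=> x Sx; have [|nx] := pselect (locally_valid (a |` S)%fset x); [by left|right].
apply: contrapT => nz; apply: nx => f g Ff fS fx; apply: nz.
exists f => //; split=> //; exists g; split=> //.
apply: contrapT => /negP ag; apply: (Sx f g Ff _ fx); apply/fsubsetP => h hg.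
by have := fsubsetP fS h hg; rewrite in_fset1U; case: eqVneq => // ha; rewrite -ha hg in ag.
Qed.

Section Extension.
Context {R : realType} (beta : R).
Hypothesis beta_gt0 : 0 < beta.
(** Finite partial sums match the finite subfamilies supplied by [card_image_bigU]. *)
Hypothesis sum_le : forall D : {fset {fmap G -> A}}, [set` D] `<=` F ->
  \sum_(f <- D) #|` domf f|%:R * beta ^ (1 - #|` domf f|%:Z) <= #|A|%:R - beta.

Lemma ntraces_violates_at a S f : a \notin S -> F f ->
  (forall T, (T `<=` S)%fset -> beta ^+ (#|` S| - #|` T|) * (nvalid T)%:R <= (nvalid S)%:R) ->
  (ntraces (a |` S)%fset (violates_at a S f))%:R <=
    #|` domf f|%:R * beta ^ (1 - #|` domf f|%:Z) * (nvalid S)%:R.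
Proof.
move=> aS Ff IH; have f_gt0 : (0 < #|` domf f|)%N by rewrite cardfs_gt0; exact: (F_patterns Ff).
(* [W s] gathers the occurrences whose position [s] lies at [a], which forces g = a s^-1. *)
pose W s := [set x | let g := (a * s^-1)%g in
  [/\ locally_valid S x, (ltranslate g (domf f) `<=` a |` S)%fset & occurs_at f g x]].
have -> : violates_at a S f = \bigcup_(s in [set` domf f]) W s.
  apply/seteqP; split=> x.
    move=> [Sx [g []]]; rewrite mem_ltranslate => ga gS fx; exists (g^-1 * a)%g => //=.
    by rewrite /W/= invgM invgK mulVKg.
  move=> [s sf [Sx gS fx]]; split=> //; exists (a * s^-1)%g; split=> //.
  by rewrite mem_ltranslate invgM invgK mulgVK.
have [D Df] := card_image_bigU (trace (a |` S)%fset) [set` domf f] W.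
rewrite -(ler_nat R) => /le_trans; apply; rewrite natr_sum.
have W_le s : s \in domf f ->
    (ntraces (a |` S)%fset (W s))%:R <= beta ^ (1 - #|` domf f|%:Z) * (nvalid S)%:R.
  move=> sf; set g := (a * s^-1)%g; set gf := ltranslate g (domf f).
  have [gfS|gfS] := boolP (gf `<=` a |` S)%fset; last first.
    have -> : W s = set0 by rewrite -subset0 => x [_]; rewrite (negbTE gfS).
    by rewrite /ntraces card_image_set0 mulr_ge0// exprz_ge0 ?ltW.
  set T := (S `\` gf)%fset.
  have agf : a \in gf by rewrite mem_ltranslate invgM invgK mulgVK.
  (* The occurrence contains [a], which is outside [S], and its other |f| - 1 points lie in [S]. *)
  have cardT : (#|` S| - #|` T| = #|` domf f|.-1)%N.
    have -> : T = ((a |` S) `\` gf)%fset.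
      by apply/fsetP => h; rewrite !inE; case: eqVneq => // ->; rewrite agf.
    have := fsubset_leq_card gfS.
    rewrite cardfsDS// cardfsU1 aS card_ltranslate; lia.
  have -> : beta ^ (1 - #|` domf f|%:Z) = (beta ^+ #|` domf f|.-1)^-1.
    by rewrite exprnN; congr (_ ^ _); lia.
  rewrite ler_pdivlMl ?exprn_gt0// -cardT; apply: le_trans (IH T (fsubsetDl _ _)).
  rewrite ler_pM2l ?exprn_gt0// ler_nat; apply: (leq_card_image (f := id)).
    by move=> x [Sx _ _]; apply: locally_validS Sx; apply: fsubsetDl.
  move=> x y [_ _ fx] [_ _ fy] /eq_trace xy; apply/eq_trace => h.
  (* On [gf] both configurations spell [f]; off it, they agree by their traces on [T]. *)
  have [hgf _|hgf] := boolP (h \in gf).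
    move: hgf; rewrite mem_ltranslate => hf.
    by rewrite -[h](mulVKg g) (fx [` hf]%fset) (fy [` hf]%fset).
  rewrite in_fset1U => /orP[/eqP ha|hS]; first by rewrite -ha (negbTE hgf) in agf.
  by apply: xy; rewrite in_fsetD hgf.
rewrite -mulrA (@le_trans _ _ (#|` D|%:R * (beta ^ (1 - #|` domf f|%:Z) * (nvalid S)%:R)))//.
  rewrite card_fset_sum1 natr_sum mulr_suml big_seq [leRHS]big_seq ler_sum// => s sD.
  by rewrite mul1r W_le//; apply: Df.
rewrite ler_wpM2r ?mulr_ge0 ?exprz_ge0 ?(ltW beta_gt0)// ler_nat fsubset_leq_card//.
by apply/fsubsetP => s; apply: Df.
Qed.

Lemma nvalid_fset1U a S : a \notin S ->
  (forall T, (T `<=` S)%fset -> beta ^+ (#|` S| - #|` T|) * (nvalid T)%:R <= (nvalid S)%:R) ->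
  beta * (nvalid S)%:R <= (nvalid (a |` S)%fset)%:R.
Proof.
move=> aS IH.
have [D DF ntr_le] := card_image_bigU (trace (a |` S)%fset) F (violates_at a S).
have : (#|A| * nvalid S <= nvalid (a |` S)%fset +
    \sum_(f <- D) ntraces (a |` S)%fset (violates_at a S f))%N.
  rewrite -(ntraces_locally_valid_fset1U aS).
  apply: leq_trans (leq_ntraces (fsubset_refl _) (@locally_valid_fset1U a S)) _.
  by apply: leq_trans (card_imageU _ _ _) _; rewrite leq_add2l.
rewrite -(ler_nat R) natrD natrM natr_sum -lerBlDr; apply: le_trans.
rewrite lerBrDr -lerBrDl -mulrBl; apply: le_trans (_ : (\sum_(f <- D)
  #|` domf f|%:R * beta ^ (1 - #|` domf f|%:Z)) * (nvalid S)%:R <= _); last first.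
  by rewrite ler_wpM2r// sum_le.
rewrite mulr_suml big_seq [leRHS]big_seq ler_sum// => f fD.
by apply: ntraces_violates_at => //; apply: DF.
Qed.

(** The statement covers all subsets [T] because deleting an occurrence of [f] from [S] removes |f|
    - 1 points at once; the induction is on [S] under strict inclusion. *)
Lemma nvalid_growth S T : (T `<=` S)%fset ->
  beta ^+ (#|` S| - #|` T|) * (nvalid T)%:R <= (nvalid S)%:R.
Proof.
elim/finSet_rect: S T => S IH T TS.
have [ST|/fsubsetPn[a aS aT]] := boolP (S `<=` T)%fset.
  by rewrite (_ : T = S) ?subnn ?mul1r//; apply/eqP; rewrite eqEfsubset TS.
rewrite -(fsetD1K aS); set S' := (S `\ a)%fset.
have aS' : a \notin S' by rewrite !inE eqxx.
have TS' : (T `<=` S')%fset by rewrite fsubsetD1 TS.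
have IH' := IH S' (fproperD1 aS).
rewrite cardfsU1 aS'.
apply: le_trans (nvalid_fset1U aS' IH').
rewrite add1n subSn ?fsubset_leq_card// exprS -mulrA ler_pM2l//.
exact: IH'.
Qed.

Lemma nvalid_ge S : beta ^+ #|` S| <= (nvalid S)%:R.
Proof.
have A_gt0 : (0 < #|A|)%N.
  (* The empty partial sum gives beta <= |A|, so the alphabet has a letter. *)
  have /sum_le : [set` fset0] `<=` F by move=> f; rewrite /= in_fset0.
  rewrite big_nil.
  by rewrite subr_ge0 -(ltr_nat R); apply: lt_le_trans.
have /card_gt0P[b _] := A_gt0.
apply: le_trans (nvalid_growth (fsub0set S)); rewrite cardfs0 subn0.
(* On the empty set a constant configuration is valid, since supports of patterns are non-empty. *)
rewrite ler_peMr ?exprn_ge0 ?(ltW beta_gt0)// ler1n ntraces_gt0//; exists (fun=> b).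
move=> f g /F_patterns f0; rewrite fsubset0 -cardfs_eq0 card_ltranslate cardfs_eq0.
by rewrite (negbTE f0).
Qed.

End Extension.
End LocallyValid.

(** * Translation invariance and compactness of the subshift *)

Section Subshift.
Context {G : groupType} {A : finType}.
Implicit Types (f : {fmap G -> A}) (g : G) (x : G -> A) (K S T : {fset G}).

Lemma ntraces_ltranslate g K (P Q : set (G -> A)) :
  (forall x, P x -> Q (fun h => x (g * h)%g)) ->
  (ntraces (ltranslate g K) P <= ntraces K Q)%N.
Proof.
move=> PQ; apply: (leq_card_image (f := fun x h => x (g * h)%g)) => // x y _ _.
move=> /eq_trace xy; apply/eq_trace => h; rewrite mem_ltranslate => /xy.
by rewrite mulVKg.
Qed.

Variable F : set {fmap G -> A}.

Lemma subshift_translate g x : subshift F x -> subshift F (fun h => x (g * h)%g).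
Proof.
by move=> Xx f Ff [k fx]; apply: (Xx f Ff); exists (g * k)%g => s; rewrite -mulgA fx.
Qed.

Lemma locally_valid_translate g T x :
  locally_valid F (ltranslate g T) x -> locally_valid F T (fun h => x (g * h)%g).
Proof.
move=> Tx f k Ff fT fx; apply: (Tx f (g * k)%g Ff) => [|s]; last by rewrite -mulgA fx.
apply/fsubsetP => h; rewrite !mem_ltranslate invgM -mulgA => hf.
by apply: (fsubsetP fT); rewrite mem_ltranslate.
Qed.

(** By translation invariance an occurrence at [g] can be moved to the identity, so a pattern
    appearing anywhere is a trace on [S] itself. *)
Lemma card_language S : #|language F S| = ntraces S (subshift F).
Proof.
apply: eq_card => p; rewrite [in LHS]inE; apply/idP/idP.
  move=> /asboolP[x Xx [g px]]; apply/mem_image_set; exists (fun h => x (g * h)%g).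
    exact: subshift_translate.
  by apply/ffunP => s; rewrite ffunE px.
move=> /mem_image_set[x Xx <-]; apply/asboolP; exists x => //; exists 1%g => s /=.
by rewrite mul1g ffunE.
Qed.

(* x is the pointwise limit, along an ultrafilter finer than the filter of finite
   sets ordered by inclusion, of configurations valid on larger and larger sets. *)
Lemma compactness K (p : {ffun K -> A}) :
  (forall T, exists2 x, locally_valid F T x & trace K x = p) ->
  exists2 x, subshift F x & trace K x = p.
Proof.
move=> valid; have /choice[y yP] T : exists x, locally_valid F T x /\ trace K x = p.
  by have [x] := valid T; exists x.
pose B : set_system {fset G} := [set E | exists T0, forall T, (T0 `<=` T)%fset -> E T].
have BF : ProperFilter B.
  apply: Build_ProperFilter_ex => [E [T0 ET0]|]; first by exists T0; apply: ET0.
  split=> [|E E' [T0 ET0] [T0' ET0']|E E' EE' [T0 ET0]]; first by exists fset0.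
    exists (T0 `|` T0')%fset => T; rewrite fsubUset => /andP[T0T T0'T].
    by split; [apply: ET0|apply: ET0'].
  by exists T0 => T /ET0/EE'.
have [U [UU BU]] := ultraFilterLemma BF.
have /choice[x xP] h : exists a, U [set T | y T h = a].
  (* Otherwise each letter [a] is avoided by [y T h] for [U]-almost all [T]; as the alphabet is
     finite, some [T] avoids all letters at once. *)
  apply: contrapT => /forallNP noa.
  have Ua a : U [set T | y T h <> a] by case: (in_ultra_setVsetC [set T | y T h = a] UU) => // /noa.
  by have [T /(_ (y T h))] := filter_ex (filter_forall _ Ua).
have U_eq S : U [set T | {in S, y T =1 x}].
  have := filter_bigI (D := S) _ (fun h _ => xP h).
  by move=> /(_ _); apply: filterS => T yx h hS; apply: yx.
have U_sub S : U [set T | (S `<=` T)%fset] by apply: BU; exists S.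
have ex S : exists2 T, (S `<=` T)%fset & {in S, y T =1 x}.
  by have [T [ST yx]] := filter_ex (filterI (U_sub S) (U_eq S)); exists T.
exists x => [f Ff [g fx]|].
  have [T gT yx] := ex (ltranslate g (domf f)).
  apply: ((yP T).1 f g Ff gT); apply: eq_occurs_at fx.
  by move=> h /yx.
have [T _ yx] := ex K.
by rewrite -(yP T).2; apply/eq_trace => h /yx.
Qed.

(** By [compactness], each trace on [K] that does not extend to the subshift is ruled out by
    validity on some finite [c p]; there are finitely many [p], so one union serves for all. *)
Lemma ntraces_subshift_attained K : exists2 T, (K `<=` T)%fset &
  (ntraces K (locally_valid F T) <= ntraces K (subshift F))%N.
Proof.
have /choice[c cP] (p : {ffun K -> A}) : exists T,
    (exists2 x, locally_valid F T x & trace K x = p) ->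
    exists2 x, subshift F x & trace K x = p.
  apply: contrapT => /forallNP np; apply: (np fset0) => _; apply: compactness => T.
  by apply: contrapT => nT; apply: (np T).
exists (K `|` \bigcup_(p <- enum {: {ffun K -> A}}) c p)%fset; first exact: fsubsetUl.
apply/subset_leq_card/fintype.subsetP => p /mem_image_set[x Tx xp].
apply/mem_image_set/cP; exists x => //; apply: locally_validS Tx.
apply: fsubset_trans (fsubsetUr _ _); apply: bigfcup_sup => //; exact: mem_enum.
Qed.

End Subshift.

(** * Shearer's inequality for translates and Folner sets *)

Section Folner.
Context {G : groupType} {A : finType}.
Implicit Types (g : G) (K Q T : {fset G}) (P : set (G -> A)).

Lemma mem_inv_fset T h : (h \in inv_fset T) = (h^-1 \in T)%g.
Proof.
apply/imfsetP/idP => [[t tT ->]|hT]; first by rewrite invgK.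
by exists (h^-1)%g; rewrite ?invgK.
Qed.

Lemma card_inv_fset T : #|` inv_fset T| = #|` T|.
Proof. by rewrite card_imfset//; apply: invg_inj. Qed.

Lemma inv_fsetK : involutive (@inv_fset G).
Proof. by move=> T; apply/fsetP => h; rewrite !mem_inv_fset invgK. Qed.

(* An upper bound on the number of g with gK meeting Q but gT not inside Q: then
   gk is in Q and gt is not for some k in K and t in T, and h = (gt)^-1 lies in
   (t^-1 k) Q^-1 but not in Q^-1. *)
Definition defect K T Q : nat :=
  (\sum_(k <- K) \sum_(t <- T)
     #|` symdiff (ltranslate (t^-1 * k)%g (inv_fset Q)) (inv_fset Q)|)%N.

(** These are the [g] for which gK meets [Q]; they index the cover of [Q]. *)
Definition meeting K Q : {fset G} := [fset (q * k^-1)%g | q in Q, k in K]%fset.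

Lemma mem_meeting K Q g k : k \in K -> (g * k)%g \in Q -> g \in meeting K Q.
Proof. by move=> kK gkQ; apply/imfset2P; exists (g * k)%g => //; exists k; rewrite ?mulgK. Qed.

(** A point q lies in gK exactly when g = q k^-1 with k in [K], and distinct k give distinct g. *)
Lemma count_meeting K Q : {in Q, forall q,
  count (fun J : {fset G} => q \in J) [seq ltranslate g K | g <- meeting K Q] = #|` K|}.
Proof.
move=> q qQ; rewrite count_map -size_filter -(size_map (fun k => q * k^-1)%g (enum_fset K)).
apply/perm_size/uniq_perm.
- by rewrite filter_uniq// fset_uniq.
- by rewrite map_inj_uniq ?fset_uniq// => k k' /mulgI/invg_inj.
move=> g; rewrite mem_filter/= mem_ltranslate; apply/andP/mapP => [[gqK _]|[k kK ->]].
  by exists (g^-1 * q)%g; rewrite // invgM invgK mulVKg.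
rewrite invgM invgK mulgVK kK; split=> //.
by apply: (mem_meeting kK); rewrite mulgVK.
Qed.

(** For a fixed k in [K], the map sending g to gk injects these translates into [Q]. *)
Lemma count_interior K T Q : (K `<=` T)%fset -> K != fset0 ->
  (count (fun g => ltranslate g T `<=` Q)%fset (meeting K Q) <= #|` Q|)%N.
Proof.
move=> KT /fset0Pn[k kK]; rewrite -size_filter -(size_map (fun g => g * k)%g).
apply: uniq_leq_size; first by rewrite map_inj_uniq ?filter_uniq ?fset_uniq//; apply: mulIg.
move=> _ /mapP[g + ->]; rewrite mem_filter => /andP[/fsubsetP gTQ _].
by apply: gTQ; rewrite mem_ltranslate mulKg (fsubsetP KT).
Qed.

Lemma count_boundary K T Q :
  (count (fun g => ~~ (ltranslate g T `<=` Q)%fset) (meeting K Q) <= defect K T Q)%N.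
Proof.
pose D (p : G * G) := symdiff (ltranslate (p.2^-1 * p.1)%g (inv_fset Q)) (inv_fset Q).
have -> : defect K T Q =
    size [seq (p.2 * h)^-1%g | p <- [seq (k, t) | k <- K, t <- T], h <- D p].
  by rewrite size_allpairs_dep sumnE big_map big_allpairs_dep/=.
rewrite -size_filter; apply: uniq_leq_size; first by rewrite filter_uniq ?fset_uniq.
move=> g; rewrite mem_filter => /andP[/fsubsetPn[u]].
rewrite mem_ltranslate => tT uQ /imfset2P[q qQ [k kK gE]]; set t := (g^-1 * u)%g in tT.
have qE : q = (g * k)%g by rewrite gE mulgVK.
apply/allpairsPdep; exists (k, t), (t^-1 * g^-1)%g; split.
- by apply/allpairsP; exists (k, t).
- rewrite !inE/= mem_ltranslate !mem_inv_fset; apply/orP; left; apply/andP; split.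
    by rewrite invgM !invgK /t mulVKg.
  by rewrite invgM invgK invgM !invgK -mulgA mulVKg -qE.
- by rewrite /= mulVKg invgK.
Qed.

(** The cover has multiplicity |K|. Translates with gT inside [Q] contribute at most [c] each, the
    others at most the trivial |A|^|K|. *)
Lemma shearer_translates K T Q P (c : nat) :
  (K `<=` T)%fset -> K != fset0 -> (0 < #|A|)%N -> (0 < c)%N ->
  (forall g, (ltranslate g T `<=` Q)%fset -> (ntraces (ltranslate g K) P <= c)%N) ->
  (ntraces Q P ^ #|` K| <= c ^ #|` Q| * (#|A| ^ #|` K|) ^ defect K T Q)%N.
Proof.
move=> KT K0 A_gt0 c_gt0 le_c.
have K_gt0 : (0 < #|` K|)%N by rewrite cardfs_gt0.
apply: leq_trans (shearer _ K_gt0 (@count_meeting K Q)) _; rewrite big_map.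
rewrite (bigID (fun g => ltranslate g T `<=` Q)%fset)/=; apply: leq_mul.
  apply: (@leq_trans (\prod_(g <- meeting K Q | (ltranslate g T `<=` Q)%fset) c)%N).
    apply: leq_prod => g gTQ; apply: leq_trans (le_c g gTQ).
    by apply: leq_ntraces => //; apply: fsubsetIl.
  by rewrite big_const_seq iter_muln muln1 leq_pexp2l ?count_interior.
apply: (@leq_trans (\prod_(g <- meeting K Q | ~~ (ltranslate g T `<=` Q)%fset) #|A| ^ #|` K|)%N).
  apply: leq_prod => g _; apply: leq_trans (ntraces_le_expn _ _) _.
  by rewrite leq_pexp2l// -(card_ltranslate g K) fsubset_leq_card// fsubsetIl.
by rewrite big_const_seq iter_muln muln1 leq_pexp2l ?count_boundary ?expn_gt0 ?A_gt0.
Qed.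

Context {R : realType}.

Lemma ln_ntraces_le K T Q P (c : nat) :
  (K `<=` T)%fset -> K != fset0 -> Q != fset0 -> P !=set0 -> (0 < c)%N ->
  (forall g, (ltranslate g T `<=` Q)%fset -> (ntraces (ltranslate g K) P <= c)%N) ->
  ln (ntraces Q P)%:R / #|` Q|%:R <=
    ln c%:R / #|` K|%:R + ln #|A|%:R * ((defect K T Q)%:R / #|` Q|%:R) :> R.
Proof.
move=> KT K0 Q0 P0 c_gt0 le_c.
have A_gt0 : (0 < #|A|)%N by have [x _] := P0; apply/card_gt0P; exists (x 1%g).
have K_gt0 : 0 < #|` K|%:R :> R by rewrite ltr0n cardfs_gt0.
have Q_gt0 : 0 < #|` Q|%:R :> R by rewrite ltr0n cardfs_gt0.
have N_gt0 := ntraces_gt0 Q P0.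
have := shearer_translates KT K0 A_gt0 c_gt0 le_c.
rewrite -(ler_nat R) natrM !natrX => le_pow.
have le_ln : ln (ntraces Q P)%:R * #|` K|%:R <=
    ln c%:R * #|` Q|%:R + ln #|A|%:R * #|` K|%:R * (defect K T Q)%:R :> R.
  rewrite !mulr_natr -!lnXn ?exprn_gt0 ?ltr0n// -lnM ?posrE ?exprn_gt0 ?ltr0n//.
  by rewrite ler_ln ?posrE ?mulr_gt0 ?exprn_gt0 ?ltr0n.
rewrite ler_pdivrMr// -(ler_pM2r K_gt0); apply: le_trans le_ln _.
by rewrite le_eqVlt; apply/orP; left; apply/eqP; field; rewrite !gt_eqF.
Qed.

(** The defect is a finite sum of symmetric differences of left translates of Q^-1, whence the
    Folner condition on the inverses. *)
Lemma cvg_defect (Q : nat -> {fset G}) K T : folner R (fun n => inv_fset (Q n)) ->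
  (fun n => (defect K T (Q n))%:R / #|` Q n|%:R : R) @ \oo --> (0 : R).
Proof.
move=> [_ Qcvg]; pose D g n : nat := #|` symdiff (ltranslate g (inv_fset (Q n))) (inv_fset (Q n))|.
have D_cvg g : (fun n => (D g n)%:R / #|` Q n|%:R : R) @ \oo --> (0 : R).
  by have := Qcvg g; under eq_cvg do rewrite card_inv_fset.
have defectE n : (defect K T (Q n))%:R / #|` Q n|%:R =
    \sum_(k <- K) \sum_(t <- T) (D (t^-1 * k)%g n)%:R / #|` Q n|%:R :> R.
  rewrite natr_sum mulr_suml; apply: eq_bigr => k _.
  by rewrite natr_sum mulr_suml.
under eq_cvg do rewrite defectE.
suff : (fun n => \sum_(k <- K) \sum_(t <- T) (D (t^-1 * k)%g n)%:R / #|` Q n|%:R : R)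
    @ \oo --> \sum_(k <- K) \sum_(t <- T) (0 : R) by rewrite !big1_eq.
apply: cvg_big; first exact: add_continuous.
move=> k _; apply: cvg_big; first exact: add_continuous.
by move=> t _; apply: D_cvg.
Qed.

End Folner.

(** * Convergence to an infimum and Fekete's lemma *)

Section Limits.
Context {R : realType}.
Implicit Types (u v d : nat -> R) (E : set R).

(** The error [d] may depend on [e]: it is enough to treat one [e] within eps / 2 of the infimum.
    This serves both Fekete's lemma and the entropy. *)
Lemma cvg_to_inf u E : has_inf E -> (\forall n \near \oo, inf E <= u n) ->
  (forall e, E e -> exists2 d, d @ \oo --> (0 : R) & \forall n \near \oo, u n <= e + d n) ->
  u @ \oo --> inf E.
Proof.
move=> infE u_ge u_le; apply/cvgrPdist_le => /= eps eps_gt0.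
have eps2_gt0 : 0 < eps / 2 by rewrite divr_gt0.
have [e Ee e_lt] := inf_adherent eps2_gt0 infE.
have [d /cvgrPdist_le/(_ _ eps2_gt0) d_le ud] := u_le _ Ee.
near=> n.
have un_ge : inf E <= u n by near: n.
rewrite ler0_norm ?subr_le0// opprB lerBlDl.
have un_le : u n <= e + d n by near: n.
have dn_le : `|0 - d n| <= eps / 2 by near: n; exact: d_le.
apply: le_trans un_le _.
have : d n <= eps / 2 by apply: le_trans dn_le; rewrite sub0r normrN ler_norm.
by move: e_lt; lra.
Unshelve. all: by end_near. Qed.

Lemma fekete v : (forall n, 0 <= v n) -> (forall m n, v (m + n)%N <= v m + v n) ->
  cvgn (fun n => v n / n%:R).
Proof.
move=> v_ge0 v_sub; pose E := [set v m / m%:R | m in [set m | (0 < m)%N]].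
have lbE : lbound E 0 by move=> _ [m _ <-]; rewrite divr_ge0.
have hasE : has_inf E by split; [exists (v 1%N / 1%:R), 1%N|exists 0].
apply/cvg_ex; exists (inf E); apply: cvg_to_inf => //.
  near=> n; apply: ge_inf; first exact: hasE.2.
  by exists n => //=; near: n; exact: nbhs_infty_gt.
(* Writing n = qm + r gives v n <= q v m + v r, and [B] bounds [v r] for every remainder r because
   [v] is nonnegative. *)
move=> _ [m /= m_gt0 <-]; pose B := \sum_(r < m) v r.
exists (fun n => B / n%:R).
  rewrite -(mulr0 B); apply: cvgM; first exact: cvg_cst.
  apply/(gtr0_cvgV0 (f := fun n : nat => n%:R : R)); last exact: cvgr_idn.
  by near=> n; rewrite ltr0n; near: n; exact: nbhs_infty_gt.
near=> n.
have n_gt0 : (0 < n)%N by near: n; exact: nbhs_infty_gt.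
have vM q r : v (q * m + r)%N <= q%:R * v m + v r.
  elim: q => [|q IH]; first by rewrite mul0n mul0r add0r.
  rewrite mulSn -addnA (le_trans (v_sub _ _))// -[q.+1]add1n natrD mulrDl mul1r -addrA.
  by rewrite lerD2l.
have vB : v (n %% m)%N <= B.
  by rewrite /B (bigD1 (Ordinal (ltn_pmod n m_gt0)))//= lerDl sumr_ge0.
have vn_le : v n <= (n %/ m)%:R * v m + B.
  by rewrite {1}(divn_eq n m) (le_trans (vM _ _))// lerD2l.
rewrite ler_pdivrMr ?ltr0n// mulrDl divfK ?pnatr_eq0 -?lt0n//.
apply: le_trans vn_le _; rewrite lerD2r [leRHS]mulrAC ler_pdivlMr ?ltr0n//.
by rewrite mulrAC mulrC ler_wpM2l// -natrM ler_nat leq_divM.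
Unshelve. all: by end_near. Qed.

End Limits.

(** * Minimal complexity over sets of a given cardinality *)

Section Complexity.
Context {G : groupType} {A : finType}.
Hypothesis G_infinite : infinite_set [set: G].
Implicit Types (S T K : {fset G}) (F : set {fmap G -> A}).

Lemma fset_of_card n : exists S : {fset G}, #|` S| = n.
Proof.
have [B _ nB] := infinite_set_fset n G_infinite.
exists [fset h | h in take n (enum_fset B)]%fset.
by rewrite card_imfset//= undup_id ?take_uniq ?fset_uniq// size_takel.
Qed.

(** The [g] for which gT meets [S] form a finite set, which cannot exhaust an infinite group. *)
Lemma disjoint_ltranslate S T : exists g, [disjoint S & ltranslate g T]%fset.
Proof.
apply: contrapT => /forallNP meets; apply: G_infinite.
apply: (@sub_finite_set _ _ [set` meeting T S]); last exact: finite_fset.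
move=> g _; apply: contrapT => /negP gST; apply: (meets g).
apply/fdisjointP => s sS; apply: contra gST; rewrite mem_ltranslate => gsT.
by apply: (mem_meeting gsT); rewrite mulVKg.
Qed.

(** An infinite group has subsets of every finite cardinality, so the minimum is attained and the
    default value of [xget] is never taken. *)
Lemma min_complexityP F n :
  (exists2 S, #|` S| = n & min_complexity F n = ntraces S (subshift F)) /\
  forall S, #|` S| = n -> (min_complexity F n <= ntraces S (subshift F))%N.
Proof.
have [S0 S0n] := fset_of_card n.
have exm : exists m, `[< complexities F n m >].
  by exists #|language F S0|; apply/asboolP; exists S0.
have : exists m, (complexities F n `&` lbound (complexities F n)) m.
  exists (ex_minn exm); case: ex_minnP => m /asboolP Cm m_min; split=> // k Ck.
  by apply: m_min; apply/asboolP.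
move=> [m minm]; case: (xgetPex 0%N (ex_intro _ m minm)) => [[S Sn SE] lb]; split=> [|T Tn].
  by exists S => //; rewrite /min_complexity -SE card_language.
by rewrite -card_language; apply: lb; exists T.
Qed.

(** Translating one minimiser away from the other yields a set of m + n points whose traces are
    determined by pairs of traces. *)
Lemma min_complexityD F m n :
  (min_complexity F (m + n) <= min_complexity F m * min_complexity F n)%N.
Proof.
have [[S Sm ->] _] := min_complexityP F m; have [[T Tn ->] _] := min_complexityP F n.
have [g STg] := disjoint_ltranslate S T.
have cardST : #|` (S `|` ltranslate g T)%fset| = (m + n)%N.
  by rewrite cardfsU (eqP STg) cardfs0 subn0 card_ltranslate Sm Tn.
apply: leq_trans ((min_complexityP F (m + n)).2 _ cardST) _.
apply: leq_trans (ntracesU _ _ _) _; rewrite leq_mul2l.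
by rewrite ntraces_ltranslate ?orbT// => x; apply: subshift_translate.
Qed.

End Complexity.

(** * Lower bounds for the subshift, its growth and its entropy *)

Section LowerBound.
Context {R : realType} {G : groupType} {A : finType}.
Variables (F : set {fmap G -> A}) (beta : R).
Hypotheses (F_patterns : F `<=` patterns G A) (beta_gt0 : 0 < beta).
Hypothesis sum_le : forall D : {fset {fmap G -> A}}, [set` D] `<=` F ->
  \sum_(f <- D) #|` domf f|%:R * beta ^ (1 - #|` domf f|%:Z) <= #|A|%:R - beta.

Lemma locally_valid_nonempty S : locally_valid F S !=set0.
Proof.
apply/set0P/eqP => S0; have := nvalid_ge F_patterns beta_gt0 sum_le S.
by rewrite /nvalid S0 /ntraces card_image_set0 leNgt exprn_gt0.
Qed.

(** On the empty set of points a non-empty set of configurations has one trace and the empty set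
    none, so [ntraces_subshift_attained] transfers non-emptiness. *)
Lemma subshift_nonempty : subshift F !=set0.
Proof.
apply/set0P/eqP => X0; have [T _] := ntraces_subshift_attained F fset0.
rewrite X0 {2}/ntraces card_image_set0 leqNgt.
by rewrite ntraces_gt0//; apply: locally_valid_nonempty.
Qed.

Lemma ln_ntraces_subshift_ge K : amenable R G -> K != fset0 ->
  ln beta <= ln (ntraces K (subshift F))%:R / #|` K|%:R.
Proof.
move=> [S folS] K0; have [T KT le_X] := ntraces_subshift_attained F K.
(* The defect involves the inverses of the [Q n], so these are chosen to make the inverses the given
   Folner sequence. *)
pose Q n := inv_fset (S n).
have folQ : folner R (fun n => inv_fset (Q n)).
  by rewrite (_ : (fun n => _) = S)//; apply/funext => n; rewrite inv_fsetK.
have X_gt0 := ntraces_gt0 K subshift_nonempty.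
set c := ln (ntraces K (subshift F))%:R / #|` K|%:R.
pose u n : R := c + ln #|A|%:R * ((defect K T (Q n))%:R / #|` Q n|%:R).
have u_cvg : u @ \oo --> c.
  rewrite -[X in _ --> X]addr0 -(mulr0 (ln #|A|%:R)).
  apply: cvgD; first exact: cvg_cst.
  by apply: cvgM; [exact: cvg_cst|exact: cvg_defect].
apply: (cvgr_to_ge u_cvg); near=> n.
have Q0 : Q n != fset0 by rewrite -cardfs_gt0 card_inv_fset cardfs_gt0; apply: folS.1.
have Q_gt0 : 0 < #|` Q n|%:R :> R by rewrite ltr0n cardfs_gt0.
(* Validity on [Q n] restricts to gT and, translated back, to [T], where the choice of [T] bounds
   the traces on [K]. *)
have le_c g : (ltranslate g T `<=` Q n)%fset ->
    (ntraces (ltranslate g K) (locally_valid F (Q n)) <= ntraces K (subshift F))%N.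
  move=> gTQ; apply: leq_trans le_X; apply: ntraces_ltranslate => x.
  by move=> /(locally_validS gTQ); apply: locally_valid_translate.
apply: le_trans (ln_ntraces_le KT K0 Q0 (locally_valid_nonempty (Q n)) X_gt0 le_c).
rewrite ler_pdivlMr// mulr_natr -lnXn// ler_ln ?posrE ?exprn_gt0 ?ltr0n//.
  exact: nvalid_ge.
by apply: ntraces_gt0; apply: locally_valid_nonempty.
Unshelve. all: by end_near. Qed.

Lemma ntraces_subshift_ge K : amenable R G ->
  beta ^+ #|` K| <= (ntraces K (subshift F))%:R.
Proof.
move=> amG; have X_gt0 := ntraces_gt0 K subshift_nonempty.
have [->|K0] := eqVneq (K : {fset G}) fset0.
  by rewrite cardfs0 ler1n ntraces_gt0//; apply: subshift_nonempty.
rewrite -ler_ln ?posrE ?exprn_gt0 ?ltr0n// lnXn// -[_ *+ #|` K|]mulr_natr -ler_pdivlMr.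
  exact: ln_ntraces_subshift_ge.
by rewrite ltr0n cardfs_gt0.
Qed.

Lemma growth_ge : infinite_set [set: G] -> amenable R G -> beta <= growth F.
Proof.
move=> G_inf amG; pose a n := min_complexity F n; pose v n : R := ln (a n)%:R.
have a_gt0 n : (0 < a n)%N.
  rewrite /a; have [[S _ ->] _] := min_complexityP G_inf F n.
  exact: (ntraces_gt0 S subshift_nonempty).
have v_cvg : cvgn (fun n => v n / n%:R).
  apply: fekete => [n|m n]; first by rewrite ln_ge0// ler1n.
  rewrite -lnM ?posrE ?ltr0n// ler_ln ?posrE ?mulr_gt0 ?ltr0n// -natrM ler_nat.
  exact: min_complexityD.
apply: limr_ge.
  (* The root is the exponential of v n / n, which converges by [fekete]. *)
  apply/cvg_ex; exists (expR (limn (fun n => v n / n%:R))).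
  have -> : (fun n => (a n)%:R `^ n%:R^-1) = expR \o (fun n => v n / n%:R).
    by apply/funext => n; rewrite /powR pnatr_eq0 gtn_eqF//= mulrC.
  by apply: continuous_cvg => //; apply: continuous_expR.
near=> n.
have n_gt0 : (0 < n)%N by near: n; exact: nbhs_infty_gt.
have [[S Sn aE] _] := min_complexityP G_inf F n.
have -> : beta = (beta ^+ n) `^ n%:R^-1.
  by rewrite -powR_mulrn ?(ltW beta_gt0)// -powRrM mulfV ?powRr1 ?(ltW beta_gt0)// pnatr_eq0 -lt0n.
rewrite ge0_ler_powR ?nnegrE ?exprn_ge0 ?(ltW beta_gt0)//.
by rewrite aE -Sn ntraces_subshift_ge.
Unshelve. all: by end_near. Qed.

Lemma entropy_ge (S : nat -> {fset G}) : amenable R G -> symmetric_folner R S ->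
  ((ln beta)%:E <= entropy F S)%E.
Proof.
move=> amG [folS symS].
(* Here symmetry of the sequence supplies the Folner condition on the inverses. *)
have folQ : folner R (fun n => inv_fset (S n)).
  by rewrite (_ : (fun n => _) = S)//; apply/funext => n; rewrite -symS.
pose h K : R := ln (ntraces K (subshift F))%:R / #|` K|%:R.
pose E := [set h K | K in [set K | K != fset0]].
have lbE : lbound E (ln beta) by move=> _ [K K0 <-]; apply: ln_ntraces_subshift_ge.
have hasE : has_inf E.
  by split; [exists (h (S 0%N)), (S 0%N) => //; apply: folS.1|exists (ln beta)].
have h_cvg : h \o S @ \oo --> inf E.
  apply: cvg_to_inf => //.
    by near=> n; apply: ge_inf; [exact: hasE.2|exists (S n) => //; apply: folS.1].
  move=> _ [K K0 <-].
  (* The choice T = K suffices: translation invariance bounds the traces on every gK by those on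
     [K]. *)
  exists (fun n => ln #|A|%:R * ((defect K K (S n))%:R / #|` S n|%:R)).
    by rewrite -(mulr0 (ln #|A|%:R)); apply: cvgM; [exact: cvg_cst|exact: cvg_defect].
  near=> n; apply: ln_ntraces_le => //; first exact: folS.1.
  - exact: subshift_nonempty.
  - by apply: (ntraces_gt0 _ subshift_nonempty).
  - by move=> g _; apply: ntraces_ltranslate => x; apply: subshift_translate.
(* The subshift is non-empty, so all counts are positive and [lne] stays finite. *)
rewrite /entropy (_ : (fun n => _) = EFin \o (h \o S)); last first.
  apply/funext => n; rewrite lne_EFin ?card_language//.
  by rewrite ltr0n; exact: (ntraces_gt0 (S n) subshift_nonempty).
have -> : limn (EFin \o (h \o S)) = (inf E)%:E.
  by apply: cvg_lim => //; apply: cvg_EFin h_cvg; apply: nearW.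
rewrite lee_fin.
by apply: lb_le_inf; first exact: hasE.1.
Unshelve. all: by end_near. Qed.

End LowerBound.

Theorem theorem12 (R : realType) (G : groupType) (A : finType)
    (F : set {fmap G -> A}) (beta : R) :
  countable [set: G] -> infinite_set [set: G] -> amenable R G ->
  F `<=` patterns G A ->
  0 < beta ->
  (beta%:E <= #|A|%:R%:E -
     \esum_(f in F) (#|` domf f|%:R * beta ^ (1 - #|` domf f|%:Z))%:E)%E ->
  beta <= growth F /\
  (forall S : nat -> {fset G}, symmetric_folner R S ->
     ((ln beta)%:E <= entropy F S)%E).
Proof.
move=> _ G_inf amG F_patterns beta_gt0 beta_le.
have sum_le (D : {fset {fmap G -> A}}) : [set` D] `<=` F ->
    \sum_(f <- D) #|` domf f|%:R * beta ^ (1 - #|` domf f|%:Z) <= #|A|%:R - beta.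
  (* Every finite partial sum is at most the full sum, so subtracting it from |A| leaves at least
     beta. *)
  move=> DF; rewrite lerBrDl -lerBrDr -lee_fin EFinB; apply: le_trans beta_le _.
  rewrite leeB// esum_ge//; exists [set` D]; first by split=> //; exact: finite_fset.
  by rewrite -fsbig_seq ?fset_uniq// sumEFin.
split; first exact: (growth_ge F_patterns beta_gt0 sum_le).
by move=> S; exact: (entropy_ge F_patterns beta_gt0 sum_le).
Qed.
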